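(* 1. There exists an extensible graph with parameter $t=0$, and if $(\Lambda,Y)$ is an extensible graph with parameters $(t,s,\bar s)$ and $t=0$, then $(t,s,\bar s)=(0,1,1)$ and $\Lambda$ is a pentagon (a $5$-cycle). 2. The automorphism group of the pentagon $\Lambda$ is the dihedral group $D_5$; and if $\Gamma$ is a simple graph on $X=Y\cup\{x\}$ ($x\notin Y$) with $\Gamma^x=\Lambda$, then $G(\Gamma)$ acts doubly transitively on $X$ and is permutation-isomorphic to the doubly transitive action of the alternating group $A_5$ on a set of cardinality $6$.
   Context: A finite simple graph $(\Lambda,Y)$ is called extensible with parameters $(t,s,\bar s)$ (nonnegative integers) if: (1) $\Lambda$ has diameter $2$; (2) for every $y\in Y$, writing $\Lambda(y,d)$ for the set of vertices at distance $d$ from $y$: (a) $|\Lambda(y,1)|=2s$; (b) $|\Lambda(y,2)|=2\bar s$; (c) every $z\in\Lambda(y,1)$ is adjacent to exactly $\bar s$ points of $\Lambda(y,2)$ and to exactly $t=2s-\bar s-1$ points of $\Lambda(y,1)$; (d) every $z\in\Lambda(y,2)$ is adjacent to exactly $s$ points of $\Lambda(y,2)$ and to exactly $s$ points of $\Lambda(y,1)$; (3) every edge of $\Lambda$ lies in exactly $t=2s-\bar s-1$ triangles; (4) $|Y|=1+2s+2\bar s$. For a simple graph $\Gamma$ on a finite set $X$, its matrix $\mathcal{E}=(\varepsilon_{i,j})$ has $\varepsilon_{i,j}=-1$ if $i\ne j$ are adjacent, $1$ otherwise. Graphs on $X$ with matrices $\mathcal{E},\mathcal{E}'$ are associated if $\varepsilon'_{i,j}=\nu_i\nu_j\varepsilon_{i,j}$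 for some $\nu_i\in\{\pm1\}$. $G(\Gamma)$ is the group of permutations $\sigma$ of $X$ such that $\Gamma$ and its image ${}^\sigma\Gamma$ under $\sigma$ are associated. ${}^x\Gamma$ is the unique graph associated to $\Gamma$ in which $x$ is isolated, and $\Gamma^x$ is the graph induced by ${}^x\Gamma$ on $X\setminus\{x\}$. *)

(* Defs.v *)
From mathcomp Require Import all_boot all_order all_algebra all_fingroup all_solvable.
Set Implicit Arguments. Unset Strict Implicit. Unset Printing Implicit Defensive.
Import GRing.Theory.

Definition simple_graph (T : finType) (e : rel T) : Prop :=
  symmetric e /\ irreflexive e.

Definition sphere1 (T : finType) (e : rel T) (y : T) : {set T} :=
  [set z | e y z].
Definition sphere2 (T : finType) (e : rel T) (y : T) : {set T} :=
  [set z | [&& z != y, ~~ e y z & [exists w, e y w && e w z]]].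

Definition diameter2 (T : finType) (e : rel T) : Prop :=
  (forall y z : T, y != z -> e y z || [exists w, e y w && e w z]) /\
  (exists y z : T, (y != z) && ~~ e y z).

Definition nbrs_in (T : finType) (e : rel T) (z : T) (A : {set T}) : {set T} :=
  [set w in A | e z w].

(* Extensible graph with parameters (t, s, sb); t = 2s - sb - 1 is encoded
   as the nat identity t + sb + 1 = 2 s. *)
Definition extensible (T : finType) (e : rel T) (t s sb : nat) : Prop :=
  [/\ simple_graph e,
      t + sb + 1 = 2 * s &
      diameter2 e] /\
  [/\
      (forall y : T,
        [/\ #|sphere1 e y| = 2 * s,
            #|sphere2 e y| = 2 * sb,
            (forall z, z \in sphere1 e y ->
               #|nbrs_in e z (sphere2 e y)| = sb /\
               #|nbrs_in e z (sphere1 e y)| = t) &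
            (forall z, z \in sphere2 e y ->
               #|nbrs_in e z (sphere2 e y)| = s /\
               #|nbrs_in e z (sphere1 e y)| = s)]),
      (forall u v : T, e u v -> #|[set w | e u w && e v w]| = t) &
      #|T| = 1 + 2 * s + 2 * sb].

Definition cycle5_rel : rel 'I_5 :=
  fun i j => (j == (i + 1) %% 5 :> nat) || (i == (j + 1) %% 5 :> nat).

Definition is_pentagon (T : finType) (e : rel T) : Prop :=
  exists c : 'I_5 -> T, bijective c /\ forall i j, e (c i) (c j) = cycle5_rel i j.

Definition graph_aut (T : finType) (e : rel T) : {set {perm T}} :=
  [set p : {perm T} | [forall x, forall y, e (p x) (p y) == e x y]].

Definition eps (T : finType) (e : rel T) (i j : T) : int :=
  if (i != j) && e i j then (-1)%R else 1%R.

Definition sgn (b : bool) : int := if b then (-1)%R else 1%R.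

Definition associated (T : finType) (e e' : rel T) : bool :=
  [exists nu : {ffun T -> bool},
     [forall i, forall j, eps e' i j == (sgn (nu i) * sgn (nu j) * eps e i j)%R]].

Definition perm_image (T : finType) (s : {perm T}) (e : rel T) : rel T :=
  fun u v => e ((s^-1)%g u) ((s^-1)%g v).

Definition Ggroup (T : finType) (e : rel T) : {set {perm T}} :=
  [set s : {perm T} | associated e (perm_image s e)].

(* Gamma^x = Lambda, for Gamma on option Y with x = None:
   the graph associated to Gamma in which x is isolated, restricted to Y. *)
Definition switch_restrict_eq (Y : finType) (gam : rel (option Y)) (lam : rel Y) : Prop :=
  exists gam' : rel (option Y),
    [/\ simple_graph gam', associated gam gam',
        (forall v, ~~ gam' None v) &
        forall i j : Y, gam' (Some i) (Some j) = lam i j].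

Definition doubly_transitive (T : finType) (G : {set {perm T}}) : Prop :=
  forall x1 x2 y1 y2 : T, x1 != x2 -> y1 != y2 ->
    exists2 g, g \in G & g x1 = y1 /\ g x2 = y2.

Definition perm_iso (T : finType) (G : {set {perm T}})
    (aT : finGroupType) (H : {set aT}) (rT : finType) (S : {set rT})
    (to : rT -> aT -> rT) : Prop :=
  exists (f : T -> rT) (phi : {perm T} -> aT),
    [/\ injective f, f @: [set: T] = S &
        {in G &, injective phi}] /\
    [/\ phi @: G = H,
        {in G &, {morph phi : g h / (g * h)%g}} &
        forall g x, g \in G -> f (g x) = to (f x) (phi g)].

(* The doubly transitive action of A5 on 6 points: conjugation action of
   Alt 'I_5 on its six Sylow 5-subgroups. *)
Definition A5_on_6_set : {set {group {perm 'I_5}}} := ('Syl_5('Alt_('I_5)))%g.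
Definition A5_on_6_act (P : {group {perm 'I_5}}) (g : {perm 'I_5}) :
  {group {perm 'I_5}} := (P :^ g)%G.

(* Main.v *)
Require Import Defs.
From mathcomp Require Import all_boot all_order all_algebra all_fingroup all_solvable.
From mathcomp Require Import zify.

Set Implicit Arguments.
Unset Strict Implicit.
Unset Printing Implicit Defensive.

(** An extensible graph with [t = 0] is triangle-free and two vertices at distance 2
    have exactly [s] common neighbours; if [s > 1], two neighbours of a vertex [z]
    inside a second sphere would have [s + 1] of them, so [s = 1].

    Associated graphs are those with the same parity of edges on every triple of
    vertices, so [G(Gamma)] is the automorphism group of a two-graph on 6 points.
    It has order 60 and is doubly transitive. It preserves a one-factorisation of the
    complete graph on 6 points, hence acts, faithfully, on its 5 factors; the image
    has index 2 in S_5 and so is A_5. A point is sent to the Sylow 5-subgroup of its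
    stabiliser, which has order 10. *)

(** * Finite checks on numbers and permutations coded as lists *)

(** Quantifiers over ordinals become boolean tests on lists of naturals, which can be decided by
    evaluation. *)
Lemma all_iotaP n (Q : pred nat) :
  reflect (forall i : 'I_n, Q i) (all Q (iota 0 n)).
Proof.
apply: (iffP allP) => h i; first by apply: h; rewrite mem_iota ltn_ord.
by rewrite mem_iota => ltin; apply: (h (Ordinal ltin)).
Qed.

Lemma all2_iotaP m n (Q : nat -> pred nat) :
  reflect (forall (i : 'I_m) (j : 'I_n), Q i j)
          (all (fun i => all (Q i) (iota 0 n)) (iota 0 m)).
Proof. by apply: (iffP (all_iotaP _ _)) => h i; apply/all_iotaP/h. Qed.

Section PermCode.
Variables (T : finType) (n : nat) (c : 'I_n -> T) (d : T -> 'I_n).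
Hypotheses (cK : cancel c d) (dK : cancel d c).

Definition perm_code (s : {perm T}) : seq nat :=
  [seq val (d (s (c i))) | i <- enum 'I_n].

Lemma nth_perm_code s (i : 'I_n) : nth 0 (perm_code s) i = d (s (c i)).
Proof. by rewrite (nth_map i) ?size_enum_ord // nth_ord_enum. Qed.

Lemma nth_perm_code_val s x : nth 0 (perm_code s) (d x) = d (s x).
Proof. by rewrite nth_perm_code dK. Qed.

Lemma size_perm_code s : size (perm_code s) = n.
Proof. by rewrite size_map size_enum_ord. Qed.

Lemma perm_code_inj : injective perm_code.
Proof.
move=> s t est; apply/permP => x; apply: (can_inj dK); apply: val_inj => /=.
by rewrite -!nth_perm_code_val est.
Qed.

Lemma perm_code_perm s : perm_eq (perm_code s) (iota 0 n).
Proof.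
rewrite -val_enum_ord /perm_code [X in perm_eq X](map_comp val).
apply/perm_map/uniq_perm; last 2 first.
- exact: enum_uniq.
- move=> i; rewrite mem_enum; apply/mapP.
  by exists (d ((s^-1)%g (c i))); rewrite ?mem_enum // dK permKV cK.
rewrite map_inj_uniq ?enum_uniq // => i j /(can_inj dK)/perm_inj.
exact: (can_inj cK).
Qed.

Lemma perm_code_surj l : perm_eq l (iota 0 n) -> exists s, perm_code s = l.
Proof.
move=> pl; have sl : size l = n by rewrite (perm_size pl) size_iota.
(* The default [i] is never taken: all entries of [l] are below [n]. *)
pose h (i : 'I_n) : 'I_n := insubd i (nth 0 l i).
have hE i : h i = nth 0 l i :> nat.
  rewrite val_insubd ifT //.
  have := mem_nth 0 (s := l) (n := i); rewrite sl ltn_ord (perm_mem pl).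
  by rewrite mem_iota => /(_ isT).
have hI : injective (fun x => c (h (d x))).
  move=> x y /(can_inj cK) /(congr1 val) /=; rewrite !hE => /eqP.
  rewrite nth_uniq ?sl ?ltn_ord ?(perm_uniq pl) ?iota_uniq // => /eqP e.
  by apply: (can_inj dK); apply: val_inj.
exists (perm hI); apply: (@eq_from_nth _ 0); first by rewrite size_perm_code.
rewrite size_perm_code => i ltin.
by rewrite (nth_perm_code _ (Ordinal ltin)) permE !cK hE.
Qed.

(** Coding is a bijection onto the rearrangements of [iota 0 n], so the order of a permutation group
    can be found by enumeration. *)
Lemma card_perm_code (P : pred (seq nat)) :
  #|[set s | P (perm_code s)]| = count P (permutations (iota 0 n)).
Proof.
rewrite cardE -(size_map perm_code) -size_filter; apply: perm_size.
apply: uniq_perm.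
- by rewrite map_inj_uniq ?enum_uniq //; apply: perm_code_inj.
- by rewrite filter_uniq ?permutations_uniq.
move=> l; rewrite mem_filter mem_permutations; apply/mapP/andP.
  by case=> s; rewrite mem_enum inE => Ps ->; split=> //; apply: perm_code_perm.
by case=> Pl /perm_code_surj[s sl]; exists s; rewrite // mem_enum inE sl.
Qed.

End PermCode.

(** * Numerical models of the pentagon and of its two-graph *)

Definition adj5 (i j : nat) : bool := (j == (i + 1) %% 5) || (i == (j + 1) %% 5).
(** The pentagon on 0 to 4 together with the isolated vertex 5. *)
Definition adj6 (i j : nat) : bool := [&& i < 5, j < 5 & adj5 i j].

(** For a simple graph this is the parity of the number of edges in a triple, the invariant of its
    switching class. *)
Definition tri (U : Type) (e : rel U) (x y z : U) : bool := e x y (+) e y z (+) e z x.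

Definition pres5 (l : seq nat) : bool :=
  all (fun i => all (fun j => adj5 (nth 0 l i) (nth 0 l j) == adj5 i j) (iota 0 5)) (iota 0 5).

Definition pres6 (l : seq nat) : bool :=
  all (fun i => all (fun j => all (fun k =>
    tri adj6 (nth 0 l i) (nth 0 l j) (nth 0 l k) == tri adj6 i j k)
    (iota 0 6)) (iota 0 6)) (iota 0 6).

Lemma count_pres5 : count pres5 (permutations (iota 0 5)) = 10.
Proof. by vm_compute. Qed.
Lemma count_pres6 : count pres6 (permutations (iota 0 6)) = 60.
Proof. by vm_compute. Qed.

(** * The automorphism group of the pentagon *)

Section AutPentagon.
Variables (Y : finType) (lam : rel Y).
Hypothesis pent : is_pentagon lam.

Lemma graph_aut_group_set : group_set (graph_aut lam).
Proof.
apply/group_setP; split=> [|s t].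
  by rewrite inE; apply/forallP => x; apply/forallP => y; rewrite !perm1.
rewrite !inE => /'forall_forallP hs /'forall_forallP ht.
apply/forallP => x; apply/forallP => y; rewrite !permM.
by rewrite (eqP (ht _ _)) (eqP (hs _ _)).
Qed.
Canonical graph_aut_group := Group graph_aut_group_set.

Lemma card_graph_aut_pentagon : #|graph_aut lam| = 10.
Proof.
have [c [[d cK dK] ce]] := pent.
rewrite -count_pres5 -(card_perm_code cK dK); apply: eq_card => s; rewrite !inE.
have lamE x y : lam x y = adj5 (d x) (d y) by rewrite -{1}(dK x) -{1}(dK y) ce.
apply/'forall_forallP/all2_iotaP => [h i j|h x y].
  have := h (c i) (c j); rewrite !lamE -!(nth_perm_code_val dK).
  by rewrite !cK.
by have := h (d x) (d y); rewrite !nth_perm_code_val // -!lamE.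
Qed.

(** A rotation and a reflection satisfy the dihedral presentation and generate a group of the right
    order, 10. *)
Lemma graph_aut_pentagon : (graph_aut lam \isog 'D_10)%g.
Proof.
have [c [[d cK dK] ce]] := pent.
have lamE x y : lam x y = adj5 (d x) (d y) by rewrite -{1}(dK x) -{1}(dK y) ce.
pose lift5 (h : nat -> nat) x := c (inord (h (d x) %% 5)).
have lift5E h x : d (lift5 h x) = h (d x) %% 5 :> nat.
  by rewrite cK inordK ?ltn_pmod.
have lift5I (h : nat -> nat) :
    all (fun i => all (fun j => (h i %% 5 == h j %% 5) ==> (i == j))
                      (iota 0 5)) (iota 0 5) ->
  injective (lift5 h).
  move=> /all2_iotaP hI x y /(congr1 (val \o d)) /=; rewrite !lift5E => /eqP e.
  have /eqP e' := implyP (hI (d x) (d y)) e.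
  by apply: (can_inj dK); apply: val_inj.
have rotI : injective (lift5 (addn 1)) by apply: lift5I.
(* Multiplication by 4 is negation modulo 5, a reflection fixing vertex 0. *)
have refI : injective (lift5 (muln 4)) by apply: lift5I.
pose x := perm rotI; pose y := perm refI.
have xE u : d (x u) = (1 + d u) %% 5 :> nat by rewrite permE lift5E.
have yE u : d (y u) = (4 * d u) %% 5 :> nat by rewrite permE lift5E.
have chk (s t : {perm Y}) (f g : nat -> nat) :
    (forall u, d (s u) = f (d u) :> nat) -> (forall u, d (t u) = g (d u) :> nat) ->
    all (fun i => f i == g i) (iota 0 5) -> s = t.
  move=> sE tE /all_iotaP fg; apply/permP => u; apply: (can_inj dK); apply: val_inj.
  by rewrite /= sE tE; apply/eqP.
have x5 : (x ^+ 5 = 1)%g.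
  apply: (chk _ _ (iter 5 (fun i => (1 + i) %% 5)) id) => // u; last by rewrite perm1.
  by rewrite !(expgS, expg1, expg0) !permM perm1 !xE.
have y2 : (y ^+ 2 = 1)%g.
  apply: (chk _ _ (iter 2 (fun i => (4 * i) %% 5)) id) => // u; last by rewrite perm1.
  by rewrite !(expgS, expg1, expg0) !permM perm1 !yE.
have yV : (y^-1 = y)%g by apply/eqP; rewrite eq_invg_mul -y2.
have xy : (x ^ y = x^-1)%g.
  apply/eqP; rewrite eq_sym eq_invg_mul; apply/eqP.
  (* Products act from left to right, so [x * x ^ y] applies [x], [y], [x], [y] in turn, innermost
     first. *)
  apply: (chk _ _ (fun i => 4 * ((1 + 4 * ((1 + i) %% 5) %% 5) %% 5) %% 5) id) => // u;
    last by rewrite perm1.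
  by rewrite conjgE yV !permM !(xE, yE).
have ox : #[x]%g = 5.
  apply: nt_prime_order => //; apply/eqP => /permP /(_ (c ord0)) /(congr1 (val \o d)) /=.
  by rewrite xE perm1 cK.
have oy : #[y]%g = 2.
  apply: nt_prime_order => //; apply/eqP => /permP /(_ (c (inord 1))) /(congr1 (val \o d)) /=.
  by rewrite yE perm1 cK inordK.
have Ax : x \in graph_aut lam.
  rewrite inE; apply/'forall_forallP => u v; rewrite !lamE !xE.
  have /all2_iotaP h : all (fun i => all (fun j =>
      adj5 ((1 + i) %% 5) ((1 + j) %% 5) == adj5 i j) (iota 0 5)) (iota 0 5) by [].
  exact: h.
have Ay : y \in graph_aut lam.
  rewrite inE; apply/'forall_forallP => u v; rewrite !lamE !yE.
  have /all2_iotaP h : all (fun i => all (fun j =>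
      adj5 ((4 * i) %% 5) ((4 * j) %% 5) == adj5 i j) (iota 0 5)) (iota 0 5) by [].
  exact: h.
have xyA : (<[x]> <*> <[y]>)%g = graph_aut lam.
  apply/eqP; rewrite eqEcard join_subG !cycle_subG Ax Ay card_graph_aut_pentagon.
  (* The generated subgroup contains elements of the coprime orders 5 and 2, so 10 divides its
     order. *)
  apply: dvdn_leq => //; rewrite -[10]/(5 * 2) Gauss_dvd //.
  by rewrite -{1}ox -{1}oy !cardSg ?joing_subl ?joing_subr.
have isoD := @Grp_dihedral 5 isT.
apply: (introT (@isoGrpP _ _ _ _ graph_aut_group isoD)); split.
  by rewrite card_graph_aut_pentagon (card_dihedral (isT : 1 < 5)%N).
by apply/existsP; exists (x, y); rewrite /= !xpair_eqE xyA x5 y2 xy !eqxx.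
Qed.
End AutPentagon.

(** * The pentagon is extensible *)

Lemma card_ord_count n (Q : pred nat) : #|[set i : 'I_n | Q i]| = count Q (iota 0 n).
Proof.
by rewrite cardsE cardE /enum_mem size_filter -enumT -val_enum_ord count_map; apply: eq_count.
Qed.

Lemma exists_ord_has n (Q : pred nat) : [exists i : 'I_n, Q i] = has Q (iota 0 n).
Proof.
apply/existsP/hasP => [[i Qi]|[i]]; first by exists (val i); rewrite ?mem_iota ?ltn_ord.
by rewrite mem_iota => lti Qi; exists (Ordinal lti).
Qed.

Lemma cycle5_extensible : extensible cycle5_rel 0 1 1.
Proof.
(* Numerical form of the second sphere; with it every cardinality below becomes a [count] that
   evaluates. *)
pose Q2 i j := [&& j != i, ~~ adj5 i j & has (fun k => adj5 i k && adj5 k j) (iota 0 5)].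
have S1E (y : 'I_5) : sphere1 cycle5_rel y = [set z : 'I_5 | adj5 y z] by [].
have S2E (y : 'I_5) : sphere2 cycle5_rel y = [set z : 'I_5 | Q2 y z].
  by apply/setP => z; rewrite !inE /Q2 -exists_ord_has.
have N1E (y z : 'I_5) : #|nbrs_in cycle5_rel z (sphere1 cycle5_rel y)|
    = count (fun w => adj5 y w && adj5 z w) (iota 0 5).
  by rewrite -card_ord_count; apply: eq_card => w; rewrite !inE.
have N2E (y z : 'I_5) : #|nbrs_in cycle5_rel z (sphere2 cycle5_rel y)|
    = count (fun w => Q2 y w && adj5 z w) (iota 0 5).
  by rewrite -card_ord_count; apply: eq_card => w; rewrite S2E !inE.
have KE (u v : 'I_5) : #|[set w | cycle5_rel u w && cycle5_rel v w]|
    = count (fun w => adj5 u w && adj5 v w) (iota 0 5).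
  by rewrite -card_ord_count.
split; split=> //.
- split=> [i j|i]; first by rewrite /cycle5_rel orbC.
  apply/negbTE; move: i; apply/(@all_iotaP 5 (fun i => ~~ adj5 i i)).
  by vm_compute.
- split; last by exists ord0, (inord 2); rewrite -val_eqE /cycle5_rel /= inordK.
  move=> y z; have /all2_iotaP h : all (fun y => all (fun z => (y != z) ==>
    adj5 y z || has (fun k => adj5 y k && adj5 k z) (iota 0 5)) (iota 0 5)) (iota 0 5).
    by vm_compute.
  have /implyP := h y z; rewrite -exists_ord_has => h' yz; exact: h'.
- move=> y; split=> [||z|z].
  + rewrite S1E card_ord_count; apply/eqP; move: y.
    by apply/(@all_iotaP 5 (fun y => count (adj5 y) (iota 0 5) == 2)); vm_compute.
  + rewrite S2E card_ord_count; apply/eqP; move: y.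
    by apply/(@all_iotaP 5 (fun y => count (Q2 y) (iota 0 5) == 2)); vm_compute.
  + rewrite N1E N2E S1E inE.
    have /all2_iotaP h : all (fun y => all (fun z => adj5 y z ==>
      (count (fun w => Q2 y w && adj5 z w) (iota 0 5) == 1)
      && (count (fun w => adj5 y w && adj5 z w) (iota 0 5) == 0)) (iota 0 5)) (iota 0 5).
      by vm_compute.
    by move=> /(implyP (h y z)) /andP[/eqP -> /eqP ->].
  + rewrite N1E N2E S2E inE.
    have /all2_iotaP h : all (fun y => all (fun z => Q2 y z ==>
      (count (fun w => Q2 y w && adj5 z w) (iota 0 5) == 1)
      && (count (fun w => adj5 y w && adj5 z w) (iota 0 5) == 1)) (iota 0 5)) (iota 0 5).
      by vm_compute.
    by move=> /(implyP (h y z)) /andP[/eqP -> /eqP ->].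
- move=> u v; rewrite KE => uv.
  have /all2_iotaP h : all (fun y => all (fun z => adj5 y z ==>
      (count (fun w => adj5 y w && adj5 z w) (iota 0 5) == 0)) (iota 0 5)) (iota 0 5).
    by vm_compute.
  by apply/eqP; apply: (implyP (h u v)).
- by rewrite card_ord.
Qed.

(** * Extensible graphs with t = 0 *)

Section Extensible.
Variables (T : finType) (e : rel T) (s sb : nat).
Hypothesis ext : extensible e 0 s sb.

Let eC : symmetric e. Proof. by case: ext => [[[]]]. Qed.
Let eirr : irreflexive e. Proof. by case: ext => [[[]]]. Qed.

Lemma extensible0_triangle_free u v w : e u v -> e u w -> ~~ e v w.
Proof.
move=> uv uw; apply/negP => vw; case: ext => _ [_ h _].
have /eqP := h _ _ uv; rewrite cards_eq0 => /eqP/setP/(_ w).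
by rewrite !inE uw vw.
Qed.

Lemma extensible0_common_nbrs u v :
  v \in sphere2 e u -> #|[set w | e u w && e v w]| = s.
Proof.
case: ext => _ [/(_ u)[_ _ _ h] _ _] /h[_ <-].
by apply: eq_card => w; rewrite !inE.
Qed.

Lemma sphere2I u v w : v != u -> ~~ e u v -> e u w -> e w v -> v \in sphere2 e u.
Proof. by move=> vu uv uw wv; rewrite inE vu uv; apply/existsP; exists w; rewrite uw. Qed.

(* If [z] lies in the second sphere of [y], a neighbour [w] of [z] there shares no
   neighbour of [y] with [z], so its [s] common neighbours with [y] are exactly the
   remaining ones. Two such [w] then have these and [z] as common neighbours. *)
Lemma extensible0_params : s = 1 /\ sb = 1.
Proof.
case: (ext) => [[_ ssb [_ [y [z0 /andP[yz0 nyz0]]]]] [hy _ _]].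
(* The relation [sb + 1 = 2 * s] already forces [s >= 1], and then [s = 1] gives [sb = 1]. *)
suff s1 : s <= 1 by lia.
have [S1 S2 _ h2] := hy y.
have /card_gt0P[z zS] : 0 < #|sphere2 e y| by lia.
have [cB cA] := h2 z zS.
rewrite leqNgt; apply/negP => s1.
set B := nbrs_in _ _ _ in cB.
have [w wB [w' w'B ww']] : exists2 w, w \in B & exists2 w', w' \in B & w != w'.
  have /card_gt1P[w [w' [? ? ?]]] : 1 < #|B| by rewrite cB.
  by exists w => //; exists w'.
set A := nbrs_in _ _ _ in cA.
have NE v : v \in B -> [set u | e y u && e v u] = sphere1 e y :\: A.
  rewrite inE => /andP[vS zv]; apply/eqP; rewrite eqEcard.
  apply/andP; split; last first.
    rewrite extensible0_common_nbrs // cardsD S1.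
    rewrite (setIidPr _) ?cA; first by lia.
    by apply/subsetP => u; rewrite !inE => /andP[].
  apply/subsetP => u; rewrite !inE => /andP[yu vu]; rewrite yu andbT /=.
  apply/negP => zu; have := extensible0_triangle_free zv zu.
  by rewrite vu.
move: (wB) (w'B); rewrite !inE => /andP[/and3P[wy yw _] zw] /andP[/and3P[w'y yw' _] zw'].
have w'S : w' \in sphere2 e w.
  apply: (sphere2I (w := z)) => //; first by rewrite eq_sym.
    exact: (extensible0_triangle_free zw).
  by rewrite eC.
have : z |: (sphere1 e y :\: A) \subset [set u | e w u && e w' u].
  rewrite subUset sub1set !inE eC zw eC zw' /=; apply/subsetP => u uSA.
  have := uSA; rewrite -(NE _ wB) !inE => /andP[_ ->].
  by have := uSA; rewrite -(NE _ w'B) !inE => /andP[_ ->].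
move/subset_leq_card; rewrite extensible0_common_nbrs // cardsU1 -(NE _ wB).
rewrite extensible0_common_nbrs ?inE; last by move: wB; rewrite !inE => /andP[].
by move: zS; rewrite inE => /and3P[_ /negPf-> _] /=; lia.
Qed.

(** With both parameters 1, a vertex [y] has neighbours [a] and [b], each with one neighbour [p],
    [q] in the second sphere; the cycle is y, a, p, q, b. *)
Lemma extensible0_pentagon : is_pentagon e.
Proof.
have [s1 sb1] := extensible0_params.
move: ext; rewrite s1 sb1 => -[[_ _ [_ [y _]]] [hy _ cT]].
have [/eqP/cards2P[a [b [ab S1]]] S2 h1 h2] := hy y.
have ya : e y a by have := set21 a b; rewrite -S1 inE.
have yb : e y b by have := set22 a b; rewrite -S1 inE.
have nab := extensible0_triangle_free ya yb.
have [/eqP/cards1P[p pE] _] := h1 a (etrans (in_set _ _) ya).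
have [/eqP/cards1P[q qE] _] := h1 b (etrans (in_set _ _) yb).
have := set11 p; rewrite -pE inE => /andP[pS ap].
have := set11 q; rewrite -qE inE => /andP[qS bq].
have [cp2 /eqP/cards1P[p1 p1E]] := h2 p pS.
have [cq2 /eqP/cards1P[q1 q1E]] := h2 q qS.
(* A vertex of the second sphere has only one neighbour in the first, and [p] already has [a]. *)
have bp : ~~ e b p.
  apply/negP => bp; move/eqP: ab; apply.
  have : a \in nbrs_in e p (sphere1 e y) by rewrite !inE ya eC.
  have : b \in nbrs_in e p (sphere1 e y) by rewrite !inE yb eC.
  by rewrite p1E !inE => /eqP-> /eqP->.
have aq : ~~ e a q.
  apply/negP => aq; move/eqP: ab; apply.
  have : a \in nbrs_in e q (sphere1 e y) by rewrite !inE ya eC.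
  have : b \in nbrs_in e q (sphere1 e y) by rewrite !inE yb eC.
  by rewrite q1E !inE => /eqP-> /eqP->.
have npq : p != q by apply: contraNneq aq => <-.
have S2E : sphere2 e y = [set p; q].
  by apply/eqP; rewrite eq_sym eqEcard subUset !sub1set pS qS S2 cards2 npq.
(* The one neighbour of [p] inside the second sphere is not [p] itself, so it is [q]. *)
have pq : e p q.
  move: cp2; rewrite S2E => /eqP/cards1P[r rE]; have := set11 r.
  rewrite -rE !inE => /andP[/orP[] /eqP->] //; by rewrite eirr.
move: pS qS; rewrite !inE => /and3P[py yp _] /and3P[qy yq _].
pose l := [:: y; a; p; q; b].
pose c (i : 'I_5) := nth y l i.
have ce i j : e (c i) (c j) = cycle5_rel i j.
  rewrite /c; case: i j => [[|[|[|[|[|]]]]] //= ?] [[|[|[|[|[|]]]]] //= ?];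
  rewrite /cycle5_rel /= ?eirr //;
  by rewrite ?(ya, yb, ap, bq, pq, negPf yp, negPf yq, negPf nab, negPf aq, negPf bp) // eC
    ?(ya, yb, ap, bq, pq, negPf yp, negPf yq, negPf nab, negPf aq, negPf bp).
exists c; split=> //; apply: inj_card_bij; last by rewrite cT card_ord.
(* Vertices of the 5-cycle with the same neighbours coincide, so injectivity follows from adjacency
   alone. *)
move=> i j cij; have h k : cycle5_rel i k = cycle5_rel j k by rewrite -!ce cij.
have /all2_iotaP chk : all (fun i => all (fun j =>
    all (fun k => adj5 i k == adj5 j k) (iota 0 5) ==> (i == j)) (iota 0 5)) (iota 0 5) by [].
apply/val_inj/eqP; apply: (implyP (chk i j)).
by apply/all_iotaP => k; apply/eqP; apply: h.
Qed.
End Extensible.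

(** * Association of graphs in terms of triples *)

Section Associated.
Variable T : finType.
Implicit Types e : rel T.

Lemma sgn_inj : injective sgn.
Proof. by case; case. Qed.

Lemma sgnM a b : (sgn a * sgn b)%R = sgn (a (+) b).
Proof. by case: a; case: b. Qed.

Lemma eps_sgn e : irreflexive e -> forall i j, eps e i j = sgn (e i j).
Proof.
move=> eI i j; rewrite /eps /sgn; case: eqP => [->|_] /=; last by [].
by rewrite eI.
Qed.

(** Each switching sign enters a triple twice and cancels. Conversely, the signs are recovered by
    comparing the two graphs at a base vertex [o]. *)
Lemma associatedP e e' : simple_graph e -> simple_graph e' ->
  reflect (forall x y z, tri e' x y z = tri e x y z) (associated e e').
Proof.
move=> [eS eI] [eS' eI']; apply: (iffP existsP) => [[nu /'forall_forallP h] x y z|h].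
  have h' i j : e' i j = nu i (+) nu j (+) e i j.
    by apply: sgn_inj; rewrite -!sgnM -!eps_sgn //; apply/eqP.
  rewrite /tri !h'; move: (nu x) (nu y) (nu z) (e x y) (e y z) (e z x).
  by move=> [] [] [] [] [] [].
case: (pickP (@predT T)) => [o _|T0]; last first.
  by exists [ffun=> false]; apply/forallP => i; have := T0 i.
exists [ffun i => e i o (+) e' i o]; apply/'forall_forallP => i j.
(* Equality of the parities of the triple [i], [j], [o] is exactly the switching identity for the
   pair [i], [j]. *)
rewrite !ffunE !eps_sgn // !sgnM; apply/eqP; congr sgn.
have := h i j o; rewrite /tri (eS o i) (eS' o i).
by move: (e i j) (e' i j) (e i o) (e j o) (e' i o) (e' j o) => [] [] [] [] [] [].
Qed.

Lemma in_Ggroup e s : simple_graph e ->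
  (s \in Ggroup e) = [forall x, forall y, forall z, tri e (s x) (s y) (s z) == tri e x y z].
Proof.
move=> eG; rewrite inE; have eG' : simple_graph (perm_image s e).
  by case: eG => eS eI; split=> [i j|i]; [apply: eS | apply: eI].
apply/(associatedP eG eG')/idP => [h|/'forall_'forall_forallP h x y z].
  apply/'forall_'forall_forallP => x y z; rewrite -h /tri /perm_image.
  by rewrite !permK.
by have /eqP := h (s^-1 x)%g (s^-1 y)%g (s^-1 z)%g; rewrite !permKV => ->.
Qed.
End Associated.

(** * The one-factorisation of the complete graph on six points *)

(* The proper edge colouring of the complete graph on [0 .. 5] by 5 colours, where
   [5] is the point at infinity: a finite edge [i j] is coloured by the midpoint
   [(i + j) / 2] modulo 5. Its colour classes are the 5 perfect matchings of a
   one-factorisation which is determined by the triples [tri adj6]. *)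
Definition edge_col (i j : nat) : nat :=
  if i == 5 then j else if j == 5 then i else (3 * (i + j)) %% 5.

(** Equality of colours in terms of triples alone: disjoint edges [i j] and [k l] share a colour
    when the triples [i j k] and [i j l] have equal parity. *)
Definition same_col (i j k l : nat) : bool :=
  [|| (i == k) && (j == l), (i == l) && (j == k) |
   [&& i != k, i != l, j != k, j != l & tri adj6 i j k == tri adj6 i j l]].

Lemma same_colP (i j k l : 'I_6) : i != j -> k != l ->
  (edge_col i j == edge_col k l) = same_col i j k l.
Proof.
have /all2_iotaP h : all (fun i => all (fun j => all (fun k => all (fun l =>
    (i != j) ==> (k != l) ==> ((edge_col i j == edge_col k l) == same_col i j k l))
  (iota 0 6)) (iota 0 6)) (iota 0 6)) (iota 0 6) by vm_compute.
move=> ij kl; have /all2_iotaP/(_ k l)/implyP/(_ ij)/implyP/(_ kl) := h i j.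
by move/eqP.
Qed.

Lemma col_lt5 (i j : 'I_6) : i != j -> edge_col i j < 5.
Proof.
have /all2_iotaP h : all (fun i => all (fun j =>
    (i != j) ==> (edge_col i j < 5)) (iota 0 6)) (iota 0 6) by vm_compute.
exact: implyP (h i j).
Qed.

(** Moving the single ordered pair (5, 0) to every other pair is enough for double transitivity. *)
Lemma pres6_2transitive (i j : 'I_6) : i != j ->
  exists2 l, l \in filter pres6 (permutations (iota 0 6)) &
             nth 0 l 5 = i /\ nth 0 l 0 = j.
Proof.
have /all2_iotaP h : all (fun i => all (fun j => (i != j) ==>
    has (fun l => (nth 0 l 5 == i) && (nth 0 l 0 == j))
        (filter pres6 (permutations (iota 0 6)))) (iota 0 6)) (iota 0 6) by vm_compute.
by move=> /(implyP (h i j))/hasP[l lP /andP[/eqP ? /eqP ?]]; exists l.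
Qed.

(** The edge from 5 to [i] has colour [i], so the hypothesis says that all five colours are
    fixed. *)
Lemma pres6_faithful l : l \in filter pres6 (permutations (iota 0 6)) ->
  (forall i : 'I_5, edge_col (nth 0 l 5) (nth 0 l i) = i) -> l = iota 0 6.
Proof.
have /allP h : all (fun l => all (fun i => edge_col (nth 0 l 5) (nth 0 l i) == i) (iota 0 5)
    ==> (l == iota 0 6)) (filter pres6 (permutations (iota 0 6))) by vm_compute.
move=> /h/implyP H e; apply/eqP; apply: H; apply/all_iotaP => i; apply/eqP; exact: e.
Qed.

Lemma card_Alt5 : #|('Alt_('I_5))%g| = 60.
Proof. by apply: double_inj; rewrite -mul2n card_Alt card_ord. Qed.

(** * Order and double transitivity of the two-graph group *)

Section TwoGraph.
Local Open Scope group_scope.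
Variables (T : finType) (tr : T -> T -> T -> bool) (c : 'I_6 -> T) (d : T -> 'I_6).
Hypotheses (cK : cancel c d) (dK : cancel d c).
Hypothesis trE : forall x y z, tr x y z = tri adj6 (d x) (d y) (d z).

Definition two_graph_aut : {set {perm T}} :=
  [set s : {perm T} | [forall x, forall y, forall z, tr (s x) (s y) (s z) == tr x y z]].
Local Notation G := two_graph_aut.

Lemma two_graph_autP (s : {perm T}) :
  reflect (forall x y z, tr (s x) (s y) (s z) = tr x y z) (s \in G).
Proof.
by rewrite inE; apply: (iffP 'forall_'forall_forallP) => h x y z; apply/eqP; apply: h.
Qed.

Lemma two_graph_aut_group_set : group_set G.
Proof.
apply/group_setP; split=> [|s t /two_graph_autP hs /two_graph_autP ht].
  by apply/two_graph_autP => x y z; rewrite !perm1.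
by apply/two_graph_autP => x y z; rewrite !permM ht hs.
Qed.
Canonical two_graph_aut_group := Group two_graph_aut_group_set.

Lemma two_graph_aut_code (s : {perm T}) : (s \in G) = pres6 (perm_code c d s).
Proof.
apply/two_graph_autP/all2_iotaP => [h i j|h x y z].
  apply/all_iotaP => k; have := h (c i) (c j) (c k).
  by rewrite !trE -!(nth_perm_code_val dK) !cK => ->.
have /all_iotaP/(_ (d z))/eqP := h (d x) (d y).
by rewrite !nth_perm_code_val // -!trE.
Qed.

Lemma card_two_graph_aut : #|G| = 60.
Proof.
rewrite -count_pres6 -(card_perm_code cK dK).
by apply: eq_card => s; rewrite two_graph_aut_code inE.
Qed.

Lemma two_graph_aut_mem_code s :
  s \in G -> perm_code c d s \in filter pres6 (permutations (iota 0 6)).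
Proof.
by move=> Gs; rewrite mem_filter -two_graph_aut_code Gs mem_permutations perm_code_perm.
Qed.

Let oo := c ord_max.

Lemma two_graph_aut_2transitive : doubly_transitive G.
Proof.
have base x y : x != y -> exists2 s, s \in G & s oo = x /\ s (c ord0) = y.
  move=> xy; have dxy : d x != d y by rewrite (can_eq dK).
  have [l] := pres6_2transitive dxy.
  rewrite mem_filter mem_permutations => /andP[Pl /(perm_code_surj cK dK)[s sl]] [lx ly].
  exists s; first by rewrite two_graph_aut_code sl.
  by split; apply: (can_inj dK); apply: val_inj => /=;
    rewrite -(nth_perm_code_val dK) sl cK.
move=> x1 x2 y1 y2 /base[s Gs [s1 s2]] /base[t Gt [t1 t2]].
(* Go back from the first pair to the base pair [oo], [c ord0], then on to the second pair. *)
exists (s^-1 * t); first by rewrite groupM ?groupV.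
by rewrite !permM -s1 -s2 !permK.
Qed.

(** By [same_colP], equality of colours depends only on coincidences of points and on triples, all
    preserved by the group. *)
Lemma two_graph_aut_col s x y z w : s \in G -> x != y -> z != w ->
  (edge_col (d (s x)) (d (s y)) == edge_col (d (s z)) (d (s w))) =
  (edge_col (d x) (d y) == edge_col (d z) (d w)).
Proof.
move=> /two_graph_autP Gs xy zw.
rewrite !same_colP ?(can_eq dK) ?(inj_eq perm_inj) // /same_col.
by rewrite !(inj_eq val_inj) !(can_eq dK) !(inj_eq perm_inj) -!trE !Gs.
Qed.

(** * The action on the five colours *)

Definition colour_perm_of (s : {perm T}) (p : {perm 'I_5}) : bool :=
  [forall x, forall y, (x != y) ==>
    (edge_col (d (s x)) (d (s y)) == p (inord (edge_col (d x) (d y))))].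

(** Each colour occurs exactly once on the edges at [oo], so the permutation of colours is read off
    from the image of this star. *)
Lemma colour_perm_exists s : s \in G -> exists p, colour_perm_of s p.
Proof.
move=> Gs; pose star (i : 'I_5) := c (widen_ord (isT : 5 <= 6) i).
have star_oo i : oo != star i.
  by rewrite (can_eq cK) -val_eqE /= neq_ltn ltn_ord orbT.
have col_star i : edge_col (d oo) (d (star i)) = i by rewrite !cK.
pose h i : 'I_5 := inord (edge_col (d (s oo)) (d (s (star i)))).
have hE i : h i = edge_col (d (s oo)) (d (s (star i))) :> nat.
  by rewrite inordK // col_lt5 // (can_eq dK) (inj_eq perm_inj).
have hI : injective h.
  move=> i j /(congr1 val) /=; rewrite !hE => /eqP.
  by rewrite two_graph_aut_col // !col_star => /eqP/val_inj.
exists (perm hI); apply/'forall_forallP => x y; apply/implyP => xy.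
rewrite permE hE two_graph_aut_col // col_star inordK // col_lt5 //.
by rewrite (can_eq dK).
Qed.

(** The default [1] can occur only outside the group. *)
Definition colour_perm (s : {perm T}) : {perm 'I_5} :=
  odflt 1 [pick p | colour_perm_of s p].

Lemma colour_permE s x y : s \in G -> x != y ->
  edge_col (d (s x)) (d (s y)) = colour_perm s (inord (edge_col (d x) (d y))).
Proof.
move=> Gs xy; rewrite /colour_perm; case: pickP => [p /'forall_forallP h|no].
  exact/eqP/(implyP (h x y)).
by have [p] := colour_perm_exists Gs; rewrite no.
Qed.

(** Identities between colour permutations thus need testing only on edges at [oo]. *)
Lemma colour_onto (i : 'I_5) : exists2 x, oo != x & inord (edge_col (d oo) (d x)) = i.
Proof.
exists (c (widen_ord (isT : 5 <= 6) i)); last by rewrite !cK inord_val.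
by rewrite (can_eq cK) -val_eqE /= neq_ltn ltn_ord orbT.
Qed.

Lemma colour_permM : {in G &, {morph colour_perm : s t / s * t}}.
Proof.
move=> s t Gs Gt; apply/permP => i; have [x ox <-{i}] := colour_onto i.
have sx : s oo != s x by rewrite (inj_eq perm_inj).
apply: val_inj; rewrite /= permM -!colour_permE ?groupM // !permM colour_permE //.
by rewrite (colour_permE Gs) // inord_val.
Qed.
Canonical colour_morphism := Morphism colour_permM.

Lemma colour_perm_injm : 'injm colour_perm.
Proof.
apply/subsetP => s /morphpreP[Gs /set1P s1]; apply/set1P.
have h i : edge_col (d (s oo)) (d (s (c (widen_ord (isT : 5 <= 6) i)))) = i.
  rewrite colour_permE //; first by rewrite s1 perm1 !cK inord_val.
  by rewrite (can_eq cK) -val_eqE /= neq_ltn ltn_ord orbT.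
have codes : perm_code c d s = iota 0 6.
  apply: (pres6_faithful (two_graph_aut_mem_code Gs)) => i; rewrite -[RHS]h.
  by rewrite -!(nth_perm_code_val dK) !cK.
apply/permP => x; rewrite perm1; apply: (can_inj dK); apply: val_inj => /=.
by rewrite -(nth_perm_code_val dK) codes nth_iota ?add0n.
Qed.

(* A subgroup of index 2 in S_5 meets the simple group A_5 in a nontrivial
   normal subgroup, hence equals it. *)
Lemma colour_perm_Alt : colour_perm @* G = 'Alt_'I_5.
Proof.
have oI : #|colour_perm @* G| = 60 by rewrite card_injm ?colour_perm_injm ?card_two_graph_aut.
have oS : #|[set: {perm 'I_5}]| = 120 by rewrite (card_Sym 'I_5) card_ord.
set K := [group of colour_perm @* G] in oI *.
have nK : K <| [set: {perm 'I_5}].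
  apply: index2_normal; first exact: subsetT.
  by rewrite -divgS ?subsetT // oI oS.
have /simpleP[_ sA] := @simple_Alt5 'I_5 (eq_leq (esym (card_ord 5))).
have nI : K :&: 'Alt_('I_5) <| 'Alt_('I_5).
  by rewrite /normal subsetIr normsI ?normG // (subset_trans (subsetT _)) // normal_norm.
have [I1|IA] := sA _ nI; last first.
  by apply/esym/eqP; rewrite eqEcard oI card_Alt5 leqnn andbT -IA subsetIl.
(* A trivial intersection would give a product set of 3600 elements inside a group of order 120. *)
have := mul_cardG K 'Alt_('I_5); rewrite I1 cards1 muln1 oI card_Alt5 => e.
by have := subset_leq_card (subsetT (K * 'Alt_('I_5))); rewrite -e oS.
Qed.

(** * Points and Sylow 5-subgroups *)

Lemma two_graph_aut_atrans : [transitive G, on [set: T] | 'P].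
Proof.
apply/imsetP; exists oo => //; apply/esym/setP => x; rewrite in_setT.
have [->|xo] := eqVneq x oo; first exact: orbit_refl.
have [s Gs [<- _]] : exists2 s, s \in G & s oo = x /\ s x = oo.
  by apply: two_graph_aut_2transitive; rewrite // eq_sym.
exact: mem_orbit.
Qed.

(** The 5-core of the stabiliser is its normal Sylow 5-subgroup; being characteristic, it requires
    no choice and is compatible with conjugation. *)
Definition point_syl (x : T) : {group {perm 'I_5}} :=
  (colour_perm @* 'O_5('C_G[x | 'P]))%G.

Lemma card_point_stab x : #|'C_G[x | 'P]| = 10.
Proof.
have := card_orbit_stab 'P G x.
rewrite (atransP two_graph_aut_atrans) ?inE // cardsT card_two_graph_aut.
have <- : 6 = #|T| by rewrite -(bij_eq_card (Bijective cK dK)) card_ord.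
by rewrite -[60]/(6 * 10)%N => /eqP; rewrite eqn_pmul2l // => /eqP.
Qed.

Lemma point_sylJ s x : s \in G -> point_syl (s x) = (point_syl x :^ colour_perm s)%G.
Proof.
move=> Gs; apply: val_inj => /=.
rewrite -morphimJ // -pcoreJ conjIg conjGid //.
by rewrite -['C[x | _] :^ s](astab1_act 'P).
Qed.

Lemma point_syl_Sylow x : point_syl x \in A5_on_6_set.
Proof.
rewrite inE; have [P sylP] := Sylow_exists 5 'C_G[x | 'P].
have oP : #|P| = 5 by rewrite (card_Hall sylP) card_point_stab p_part.
have PO : 'O_5('C_G[x | 'P]) = P.
  (* A subgroup of order 5 in a stabiliser of order 10 has index 2, so it is normal and equals the
     core. *)
  apply: normal_Hall_pcore => //; apply: index2_normal; first exact: pHall_sub sylP.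
  by rewrite -divgS ?(pHall_sub sylP) // card_point_stab oP.
have sPG : P \subset G by rewrite (subset_trans (pHall_sub sylP)) ?subsetIl.
rewrite pHallE /= PO -{1}colour_perm_Alt morphimS //.
by rewrite card_injm ?colour_perm_injm // oP card_Alt5 p_part.
Qed.

(** If two points shared a subgroup, double transitivity would make all points share it, giving a
    normal subgroup of order 5 in the simple group A_5. *)
Lemma point_syl_inj : injective point_syl.
Proof.
move=> x y exy; apply/eqP; apply/negPn/negP => xy.
have const z : z != x -> point_syl z = point_syl x.
  move=> zx; have [s Gs [sx sy]] := two_graph_aut_2transitive xy zx.
  by rewrite -sx point_sylJ // exy -point_sylJ // sy.
have nP : point_syl x <| 'Alt_('I_5).
  have := point_syl_Sylow x; rewrite inE => /pHall_sub sPA.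
  rewrite /normal sPA -colour_perm_Alt; apply/subsetP => _ /morphimP[s Gs _ ->].
  rewrite inE -[_ :^ _]/(gval (point_syl x :^ colour_perm s)%G) -point_sylJ //.
  by have [->|/const->] := eqVneq (s x) x.
have oP : #|point_syl x| = 5.
  by have := point_syl_Sylow x; rewrite inE => /card_Hall ->; rewrite card_Alt5 p_part.
have /simpleP[_ sA] := @simple_Alt5 'I_5 (eq_leq (esym (card_ord 5))).
by have [e|e] := sA _ nP; move: oP; rewrite e ?cards1 ?card_Alt5.
Qed.

(** Sylow subgroups are conjugate in A_5, and every conjugating element is induced by the group. *)
Lemma point_syl_image : point_syl @: [set: T] = A5_on_6_set.
Proof.
apply/setP => Q; apply/imsetP/idP => [[x _ ->]|]; first exact: point_syl_Sylow.
rewrite inE => sylQ; have := point_syl_Sylow oo; rewrite inE => sylP.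
have [a Aa QE] := Sylow_trans sylP sylQ.
have /morphimP[s Gs _ aE] : a \in colour_perm @* G by rewrite colour_perm_Alt.
by exists (s oo) => //; rewrite point_sylJ // -aE; apply: val_inj.
Qed.

Lemma two_graph_aut_perm_iso : perm_iso G 'Alt_('I_5) A5_on_6_set A5_on_6_act.
Proof.
exists point_syl, colour_perm; split; split.
- exact: point_syl_inj.
- exact: point_syl_image.
- exact/injmP/colour_perm_injm.
- by rewrite -colour_perm_Alt morphimEdom.
- exact: colour_permM.
- by move=> s x Gs; apply: point_sylJ.
Qed.

End TwoGraph.

(** * From the graph on six points to the two-graph *)

Lemma Ggroup_pentagon (Y : finType) (lam : rel Y) (gam : rel (option Y)) :
  is_pentagon lam -> simple_graph gam -> switch_restrict_eq gam lam ->
  doubly_transitive (Ggroup gam) /\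
  perm_iso (Ggroup gam) ('Alt_('I_5))%g A5_on_6_set A5_on_6_act.
Proof.
move=> [c [[d cK dK] ce]] gG [gam' [g'G assoc g'0 g'lam]].
(* [insub] fails only at 5, so the label 5 goes to the added point [None]. *)
pose c6 (i : 'I_6) : option Y := omap c (insub (val i)).
pose d6 (x : option Y) : 'I_6 :=
  if x is Some y then widen_ord (isT : 5 <= 6) (d y) else ord_max.
have cK6 : cancel c6 d6.
  move=> i; apply: val_inj; rewrite /c6; case: insubP => [j _ <-|] /=; first by rewrite cK.
  by rewrite -leqNgt => i5; apply/eqP; rewrite eqn_leq i5 -ltnS ltn_ord.
have dK6 : cancel d6 c6.
  case=> [y|]; rewrite /c6; last by rewrite insubF.
  by rewrite -[val _]/(val (d y)) valK /= dK.
have gamE x y : gam' x y = adj6 (d6 x) (d6 y).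
  case: x y => [x|] [y|]; rewrite /adj6 /= ?ltn_ord ?(negPf (g'0 _)) //=.
    by rewrite g'lam -{1}(dK x) -{1}(dK y) ce.
  by rewrite g'G.1 (negPf (g'0 _)).
have trE x y z : tri gam x y z = tri adj6 (d6 x) (d6 y) (d6 z).
  (* [gam] has the same triples as the switched graph [gam'], which is [adj6] in these labels. *)
  by rewrite -(associatedP gG g'G assoc) /tri !gamE.
have -> : Ggroup gam = two_graph_aut (tri gam).
  by apply/setP => s; rewrite in_Ggroup // inE.
split; first exact: two_graph_aut_2transitive cK6 dK6 trE.
exact: two_graph_aut_perm_iso cK6 dK6 trE.
Qed.

Theorem theorem2 :
  ((exists (T : finType) (e : rel T) (s sb : nat), extensible e 0 s sb) /\
   (forall (T : finType) (e : rel T) (t s sb : nat),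
      extensible e t s sb -> t = 0 ->
      (t, s, sb) = (0, 1, 1) /\ is_pentagon e)) /\
  (forall (Y : finType) (lam : rel Y),
     simple_graph lam -> is_pentagon lam ->
     (graph_aut lam \isog 'D_10)%g /\
     (forall gam : rel (option Y),
        simple_graph gam -> switch_restrict_eq gam lam ->
        doubly_transitive (Ggroup gam) /\
        perm_iso (Ggroup gam) ('Alt_('I_5))%g A5_on_6_set A5_on_6_act)).
Proof.
split; [split|].
- by exists 'I_5, cycle5_rel, 1, 1; apply: cycle5_extensible.
- move=> T e t s sb ext t0; move: ext; rewrite t0 => ext.
  have [-> ->] := extensible0_params ext; split=> //.
  exact: extensible0_pentagon ext.
- move=> Y lam _ pent; split; first exact: graph_aut_pentagon.
  by move=> gam; apply: Ggroup_pentagon.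
Qed.
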